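(* Let $\mathcal C$ be a strong balanced factorization category and $X$ an object of $\mathcal C$. Let $\overline X\hookrightarrow\mathcal M/X$ be the full subcategory generated by the slice projections $\downarrow_X x$ ($x:1\to X$) and $\overline X'\hookrightarrow\mathcal M'/X$ the full subcategory generated by the coslice projections $\uparrow_X x$ ($x:1\to X$). Then $\overline X$ and $\overline X'$ are dual, i.e. $\overline X$ is equivalent to $(\overline X')^{op}$.
   Context: A balanced factorization category (bfc) is a finitely complete category $\mathcal C$ with two (orthogonal) factorization systems $(\mathcal E,\mathcal M)$ and $(\mathcal E',\mathcal M')$ satisfying the reciprocal stability law: the pullback of a map in $\mathcal E$ along a map in $\mathcal M'$ is in $\mathcal E$, and the pullback of a map in $\mathcal E'$ along a map in $\mathcal M$ is in $\mathcal E'$. $\mathcal M/X$ (resp. $\mathcal M'/X$) is the full subcategory of $\mathcal C/X$ on the objects lying in $\mathcal M$ (resp. $\mathcal M'$). The bfc is strong if $\mathcal M/1=\mathcal M'/1$. For a point $x:1\to X$, the slice projection $\downarrow_X x:X/x\to X$ is the second factor of an $(\mathcal E,\mathcal M)$-factorization of $x$, and the coslice projection $\uparrow_X x:x\backslash X\to X$ is the second factor of an $(\mathcal E',\mathcal M')$-factorization of $x$. *)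

(* Defs.v *)
From Stdlib Require Import FinFun ProofIrrelevance.

Set Implicit Arguments.
Unset Strict Implicit.

Record Category : Type := {
  Ob :> Type;
  hom : Ob -> Ob -> Type;
  id : forall A, hom A A;
  comp : forall A B D, hom B D -> hom A B -> hom A D;
  comp_id_l : forall A B (f : hom A B), comp (id B) f = f;
  comp_id_r : forall A B (f : hom A B), comp f (id A) = f;
  comp_assoc : forall A B D F (h : hom D F) (g : hom B D) (f : hom A B),
    comp h (comp g f) = comp (comp h g) f
}.

Arguments hom {_} _ _.
Arguments id {_} _.
Arguments comp {_ _ _ _} _ _.

Notation "g ∘ f" := (comp g f) (at level 40, left associativity).

Definition IsIso (C : Category) (A B : C) (f : hom A B) : Prop :=
  exists g : hom B A, g ∘ f = id A /\ f ∘ g = id B.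

Definition Op (C : Category) : Category := {|
  Ob := Ob C;
  hom := fun A B => @hom C B A;
  id := fun A => @id C A;
  comp := fun A B D g f => @comp C D B A f g;
  comp_id_l := fun A B f => comp_id_r f;
  comp_id_r := fun A B f => comp_id_l f;
  comp_assoc := fun A B D F h g f => eq_sym (comp_assoc f g h)
|}.

Definition FullSub (C : Category) (P : C -> Prop) : Category := {|
  Ob := {A : C | P A};
  hom := fun A B => hom (proj1_sig A) (proj1_sig B);
  id := fun A => id (proj1_sig A);
  comp := fun A B D g f => g ∘ f;
  comp_id_l := fun A B f => comp_id_l f;
  comp_id_r := fun A B f => comp_id_r f;
  comp_assoc := fun A B D F h g f => comp_assoc h g f
|}.

Record SliceOb (C : Category) (X : C) : Type := MkSliceOb {
  slice_dom : C;
  slice_arr : hom slice_dom X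
}.

Definition SliceHom (C : Category) (X : C) (A B : SliceOb X) : Type :=
  {f : hom (slice_dom A) (slice_dom B) | slice_arr B ∘ f = slice_arr A}.

Lemma slice_hom_eq (C : Category) (X : C) (A B : SliceOb X)
  (f g : SliceHom A B) :
  proj1_sig f = proj1_sig g -> f = g.
Proof.
destruct f as [f hf], g as [g hg]; simpl; intros <-.
f_equal; apply proof_irrelevance.
Qed.

Definition slice_id (C : Category) (X : C) (A : SliceOb X) : SliceHom A A :=
  exist _ (id (slice_dom A)) (comp_id_r (slice_arr A)).

Lemma slice_comp_proof (C : Category) (X : C) (A B D : SliceOb X)
  (g : SliceHom B D) (f : SliceHom A B) :
  slice_arr D ∘ (proj1_sig g ∘ proj1_sig f) = slice_arr A.
Proof. now rewrite comp_assoc, (proj2_sig g), (proj2_sig f). Qed.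

Definition slice_comp (C : Category) (X : C) (A B D : SliceOb X)
  (g : SliceHom B D) (f : SliceHom A B) : SliceHom A D :=
  exist _ (proj1_sig g ∘ proj1_sig f) (slice_comp_proof g f).

Definition Slice (C : Category) (X : C) : Category.
Proof.
refine {| Ob := SliceOb X; hom := @SliceHom C X;
          id := @slice_id C X; comp := @slice_comp C X |};
  intros; apply slice_hom_eq; simpl.
- apply comp_id_l.
- apply comp_id_r.
- apply comp_assoc.
Defined.

Record Functor (C D : Category) : Type := {
  fob :> C -> D;
  fmap : forall A B : C, hom A B -> hom (fob A) (fob B);
  fmap_id : forall A : C, fmap (id A) = id (fob A);
  fmap_comp : forall (A B F : C) (g : hom B F) (f : hom A B),
    fmap (g ∘ f) = fmap g ∘ fmap f
}.

Definition FunctorId (C : Category) : Functor C C := {|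
  fob := fun A => A;
  fmap := fun A B f => f;
  fmap_id := fun A => eq_refl;
  fmap_comp := fun A B F g f => eq_refl
|}.

Definition FunctorComp (C D F : Category) (G : Functor D F) (H : Functor C D) :
  Functor C F.
Proof.
refine {| fob := fun A => G (H A); fmap := fun A B f => fmap G (fmap H f) |}.
- intros A; now rewrite !fmap_id.
- intros A B K g f; now rewrite !fmap_comp.
Defined.

Definition NatIsomorphic (C D : Category) (F G : Functor C D) : Prop :=
  exists eta : forall A : C, hom (F A) (G A),
    (forall A, IsIso (eta A)) /\
    (forall (A B : C) (f : hom A B), eta B ∘ fmap F f = fmap G f ∘ eta A).

Definition Equivalent (C D : Category) : Prop :=
  exists (F : Functor C D) (G : Functor D C),
    NatIsomorphic (FunctorComp G F) (FunctorId C) /\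
    NatIsomorphic (FunctorComp F G) (FunctorId D).

Definition Dual (C D : Category) : Prop := Equivalent C (Op D).

Definition FiniteCategory (J : Category) : Prop :=
  Finite J /\ forall i j : J, Finite (hom i j).

Definition IsCone (J C : Category) (D : Functor J C) (L : C)
  (p : forall j : J, hom L (D j)) : Prop :=
  forall (i j : J) (u : hom i j), fmap D u ∘ p i = p j.

Definition IsLimit (J C : Category) (D : Functor J C) (L : C)
  (p : forall j : J, hom L (D j)) : Prop :=
  IsCone p /\
  forall (T : C) (q : forall j : J, hom T (D j)), IsCone q ->
    exists! h : hom T L, forall j, p j ∘ h = q j.

Definition FinitelyComplete (C : Category) : Prop :=
  forall (J : Category) (D : Functor J C), FiniteCategory J ->
    exists (L : C) (p : forall j : J, hom L (D j)), IsLimit p.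

Definition IsTerminal (C : Category) (T : C) : Prop :=
  forall A : C, exists! f : hom A T, True.

(*  P --q--> B
    |        |
    p        g
    v        v
    A --f--> D   *)
Definition IsPullback (C : Category) (P A B D : C)
  (p : hom P A) (q : hom P B) (f : hom A D) (g : hom B D) : Prop :=
  f ∘ p = g ∘ q /\
  forall (T : C) (a : hom T A) (b : hom T B), f ∘ a = g ∘ b ->
    exists! h : hom T P, p ∘ h = a /\ q ∘ h = b.

Definition MorphismClass (C : Category) : Type :=
  forall A B : C, hom A B -> Prop.

Definition Orthogonal (C : Category) (A B K L : C)
  (e : hom A B) (m : hom K L) : Prop :=
  forall (u : hom A K) (v : hom B L), m ∘ u = v ∘ e ->
    exists! d : hom B K, d ∘ e = u /\ m ∘ d = v.

Record FactorizationSystem (C : Category) (E M : MorphismClass C) : Prop := {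
  fs_iso_E : forall (A B : C) (f : hom A B), IsIso f -> E A B f;
  fs_iso_M : forall (A B : C) (f : hom A B), IsIso f -> M A B f;
  fs_comp_E : forall (A B D : C) (g : hom B D) (f : hom A B),
    E B D g -> E A B f -> E A D (g ∘ f);
  fs_comp_M : forall (A B D : C) (g : hom B D) (f : hom A B),
    M B D g -> M A B f -> M A D (g ∘ f);
  fs_factor : forall (A B : C) (f : hom A B),
    exists (I : C) (e : hom A I) (m : hom I B),
      E A I e /\ M I B m /\ m ∘ e = f;
  fs_orth : forall (A B K L : C) (e : hom A B) (m : hom K L),
    E A B e -> M K L m -> Orthogonal e m
}.

Definition StableAlong (C : Category) (E N : MorphismClass C) : Prop :=
  forall (P A B D : C) (p : hom P A) (q : hom P B) (n : hom A D) (e : hom B D),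
    IsPullback p q n e -> N A D n -> E B D e -> E P A p.

Record BalancedFactorizationCategory (C : Category)
  (E M E' M' : MorphismClass C) : Prop := {
  bfc_finitely_complete : FinitelyComplete C;
  bfc_fs : FactorizationSystem E M;
  bfc_fs' : FactorizationSystem E' M';
  bfc_stable : StableAlong E M';
  bfc_stable' : StableAlong E' M
}.

Definition InClass (C : Category) (M : MorphismClass C) (X : C)
  (A : Slice X) : Prop :=
  M (slice_dom A) X (slice_arr A).

Definition ClassSlice (C : Category) (M : MorphismClass C) (X : C) : Category :=
  FullSub (@InClass C M X).

(* Equality of M/1 and M'/1 as full subcategories of C/1: they have the same
   objects. *)
Definition Strong (C : Category) (M M' : MorphismClass C) (one : C) : Prop :=
  forall A : Slice one, InClass M A <-> InClass M' A.

(* A is the second factor of an (E,M)-factorization of x; membership of A in M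
   is part of its type. *)
Definition IsProjectionAt (C : Category) (E M : MorphismClass C) (one X : C)
  (x : hom one X) (A : ClassSlice M X) : Prop :=
  exists e : hom one (slice_dom (proj1_sig A)),
    E one (slice_dom (proj1_sig A)) e /\ slice_arr (proj1_sig A) ∘ e = x.

(* The slice projections of X for (E,M); applied to (E',M') it gives the
   coslice projections.  No factorization is chosen: every second factor of
   every factorization of a point is an object. *)
Definition ProjectionCategory (C : Category) (E M : MorphismClass C)
  (one X : C) : Category :=
  FullSub (fun A : ClassSlice M X =>
    exists x : hom one X, IsProjectionAt E x A).

(* Main.v *)
(* For points x, y of X, arrows ↓x -> ↓y over X are the points of X/y over x,
   and arrows ↑y -> ↑x are the points of x\X over y.  Let P be the pullback of
   ↑x and ↓y.  The fibre of P over the universal point of X/y is included in P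
   by a map in E, and is an object of M'/1 = M/1, so it is a reflection of P
   in M/1; dually, the fibre of P over the universal point of x\X is a
   reflection of P in M'/1 = M/1.  Thus both sets of arrows are identified with
   the points of the same reflection, the "set of components" of P.  The
   resulting bijection respects composition because P is functorial in both of
   its factors. *)
From Stdlib Require Import FinFun List ClassicalEpsilon.
Require Import Defs.
Import ListNotations.

Set Implicit Arguments.
Unset Strict Implicit.

(** * Pullbacks as limits of cospan diagrams *)

Inductive cospan : Set := cospan_l | cospan_r | cospan_c.

Definition cospan_hom (i j : cospan) : Set :=
  match i, j with
  | cospan_l, cospan_l | cospan_r, cospan_r | cospan_c, cospan_c => unit
  | cospan_l, cospan_c | cospan_r, cospan_c => unit
  | _, _ => Empty_set
  end.

Lemma cospan_hom_eq (i j : cospan) (f g : cospan_hom i j) : f = g.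
Proof. destruct i, j, f, g; reflexivity. Qed.

Definition cospan_id (i : cospan) : cospan_hom i i.
Proof. destruct i; exact tt. Defined.

Definition cospan_comp (i j k : cospan) :
  cospan_hom j k -> cospan_hom i j -> cospan_hom i k.
Proof.
destruct i, j, k; intros v u; first [exact tt | now destruct v | now destruct u].
Defined.

Definition Cospan : Category.
Proof.
refine {| Ob := cospan; hom := cospan_hom;
          id := cospan_id; comp := cospan_comp |};
  intros; apply cospan_hom_eq.
Defined.

Lemma cospan_finite : FiniteCategory Cospan.
Proof.
split.
- exists [cospan_l; cospan_r; cospan_c]; intros []; simpl; tauto.
- intros [] [];
    ((exists [tt]; intros []; simpl; tauto) || (exists []; intros [])).
Qed.

Definition cospan_diagram (C : Category) (A B D : C)
  (f : hom A D) (g : hom B D) : Functor Cospan C.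
Proof.
unshelve refine {|
  fob := fun i : Cospan =>
    match i return C with cospan_l => A | cospan_r => B | cospan_c => D end;
  fmap := fun i j =>
    match i, j return cospan_hom i j ->
      hom (match i with cospan_l => A | cospan_r => B | cospan_c => D end)
          (match j with cospan_l => A | cospan_r => B | cospan_c => D end) with
    | cospan_l, cospan_l => fun _ => id A
    | cospan_r, cospan_r => fun _ => id B
    | cospan_c, cospan_c => fun _ => id D
    | cospan_l, cospan_c => fun _ => f
    | cospan_r, cospan_c => fun _ => g
    | cospan_l, cospan_r | cospan_r, cospan_l
    | cospan_c, cospan_l | cospan_c, cospan_r => fun u => match u with end
    end |}.
- intros []; reflexivity.
- intros [] [] [] u v; destruct u, v; simpl;
    now rewrite ?comp_id_l, ?comp_id_r.
Defined.

Lemma pullback_exists (C : Category) (hC : FinitelyComplete C) (A B D : C)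
  (f : hom A D) (g : hom B D) :
  exists (P : C) (p : hom P A) (q : hom P B), IsPullback p q f g.
Proof.
destruct (hC Cospan (cospan_diagram f g) cospan_finite) as (P & c & hc & hu).
exists P, (c cospan_l), (c cospan_r); split.
- transitivity (c cospan_c).
  + exact (hc cospan_l cospan_c tt).
  + exact (eq_sym (hc cospan_r cospan_c tt)).
- intros T a b hab.
  destruct (hu T (fun j : Cospan => match j return hom T (cospan_diagram f g j)
    with cospan_l => a | cospan_r => b | cospan_c => f ∘ a end))
    as (h & hh & uh).
  + intros [] [] []; simpl; now rewrite ?comp_id_l.
  + exists h; split.
    * exact (conj (hh cospan_l) (hh cospan_r)).
    * intros h' [h1 h2]; apply uh; intros []; [exact h1 | exact h2 |].
      rewrite <- h1, comp_assoc; f_equal.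
      exact (eq_sym (hc cospan_l cospan_c tt)).
Qed.

Lemma pullback_sym (C : Category) (P A B D : C)
  (p : hom P A) (q : hom P B) (f : hom A D) (g : hom B D) :
  IsPullback p q f g -> IsPullback q p g f.
Proof.
intros [hc hu]; split; [now symmetry |].
intros T a b hab; destruct (hu T b a (eq_sym hab)) as (h & [h1 h2] & uh).
exists h; split; [now split |]; intros h' [k1 k2]; apply uh; now split.
Qed.

Lemma pullback_ext (C : Category) (P A B D : C)
  (p : hom P A) (q : hom P B) (f : hom A D) (g : hom B D) :
  IsPullback p q f g -> forall (T : C) (h k : hom T P),
  p ∘ h = p ∘ k -> q ∘ h = q ∘ k -> h = k.
Proof.
intros [hc hu] T h k hp hq; destruct (hu T (p ∘ k) (q ∘ k)) as (l & _ & ul).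
- now rewrite !comp_assoc, hc.
- rewrite <- (ul h), <- (ul k); auto.
Qed.

Lemma terminal_hom_eq (C : Category) (one : C) (hone : IsTerminal one) (A : C)
  (f g : hom A one) : f = g.
Proof. destruct (hone A) as (h & _ & u); now rewrite <- (u f), <- (u g). Qed.

(** * Right classes and unique extension *)

Section FactorizationSystem.

Context (C : Category) (E M : MorphismClass C).
Context (hEM : FactorizationSystem E M).

(** In a factorization [f = m ∘ e], lifting [e] against [f] gives a retraction [d] of [e]. Since
    [e ∘ d] and the identity fill the same square of [e] against [m], the map [e] is invertible. *)
Lemma orthogonal_right_class (A B : C) (f : hom A B) :
  (forall (K L : C) (e : hom K L), E e -> Orthogonal e f) -> M f.
Proof.
intros hf; destruct (fs_factor hEM f) as (I & e & m & he & hm & hme).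
destruct (hf _ _ e he (id A) m) as (d & [hde hfd] & _).
{ now rewrite comp_id_r. }
assert (hed : e ∘ d = id I).
{ destruct (fs_orth hEM he hm (u := e) (v := m) eq_refl) as (k & _ & uk).
  rewrite <- (uk (e ∘ d)), <- (uk (id I)); [reflexivity | |]; split.
  - apply comp_id_l.
  - apply comp_id_r.
  - now rewrite <- comp_assoc, hde, comp_id_r.
  - now rewrite comp_assoc, hme. }
rewrite <- hme; apply (fs_comp_M hEM); [exact hm |].
apply (fs_iso_M hEM); now exists d.
Qed.

(** A filler against [g], paired with [v], factors through the pullback and gives the filler against
    [p]. *)
Lemma right_class_pullback (P A B D : C)
  (p : hom P A) (q : hom P B) (f : hom A D) (g : hom B D) :
  IsPullback p q f g -> M g -> M p.
Proof.
intros hpb hg; apply orthogonal_right_class; intros K L e he u v huv.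
destruct (fs_orth hEM he hg (u := q ∘ u) (v := f ∘ v)) as (d & [d1 d2] & ud).
{ now rewrite comp_assoc, <- (proj1 hpb), <- comp_assoc, huv, comp_assoc. }
destruct (proj2 hpb L v d (eq_sym d2)) as (h & [h1 h2] & _).
exists h; split; [split; [| exact h1] |].
- apply (pullback_ext hpb); rewrite comp_assoc.
  + now rewrite h1.
  + now rewrite h2.
- intros h' [k1 k2]; apply (pullback_ext hpb).
  + now rewrite h1, k2.
  + rewrite h2; apply ud; split.
    * now rewrite <- comp_assoc, k1.
    * now rewrite comp_assoc, <- (proj1 hpb), <- comp_assoc, k2.
Qed.

(** With [T] terminal, this turns arrows out of a slice or coslice projection into points over its
    base point. *)
Lemma slice_hom_extension (X : C) (A B : SliceOb X) (T : C)
  (e : hom T (slice_dom A)) (u : hom T (slice_dom B)) :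
  E e -> M (slice_arr B) -> slice_arr B ∘ u = slice_arr A ∘ e ->
  exists! f : SliceHom A B, proj1_sig f ∘ e = u.
Proof.
intros he hB hu; destruct (fs_orth hEM he hB hu) as (d & [d1 d2] & ud).
exists (exist _ d d2); split; [exact d1 |].
intros [f hf] h; apply slice_hom_eq; simpl in *; apply ud; now split.
Qed.

End FactorizationSystem.

(** * Components of products over X *)

(* The points u and v have the same image in the reflection of P in M/1. *)
Definition SameComponent (C : Category) (M : MorphismClass C) (one P : C)
  (u v : hom one P) : Prop :=
  forall (S : C) (t : hom S one), M S one t ->
  forall s : hom P S, s ∘ u = s ∘ v.

(* The pairs (a, b) and (a', b') are points in the same component of the
   product of A and B over X. *)
Definition Connected (C : Category) (M : MorphismClass C) (one X : C)
  (A B : SliceOb X) (a : hom one (slice_dom A)) (b : hom one (slice_dom B))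
  (a' : hom one (slice_dom A)) (b' : hom one (slice_dom B)) : Prop :=
  forall (P : C) (p : hom P (slice_dom A)) (q : hom P (slice_dom B)),
  IsPullback p q (slice_arr A) (slice_arr B) ->
  forall u v : hom one P, p ∘ u = a -> q ∘ u = b -> p ∘ v = a' -> q ∘ v = b' ->
  SameComponent M u v.

Section Components.

Context (C : Category) (hlim : FinitelyComplete C).
Context (one : C) (hone : IsTerminal one).

(* Any map to an object of M/1 is determined by its restriction to the fibre of
   q over e, which is itself an object of M/1; so this fibre is a retract of P
   meeting each component in exactly one point. *)
Lemma unique_fiber_representative (E M N : MorphismClass C)
  (hEM : FactorizationSystem E M) (hE : StableAlong E N)
  (hpb : forall (P A B D : C)
     (p : hom P A) (q : hom P B) (f : hom A D) (g : hom B D),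
     IsPullback p q f g -> N B D g -> N P A p)
  (hN : forall (S : C) (t : hom S one), N S one t -> M S one t)
  (P B : C) (q : hom P B) (hq : N P B q)
  (e : hom one B) (he : E one B e) (u : hom one P) :
  exists! v : hom one P, q ∘ v = e /\ SameComponent M u v.
Proof.
destruct (pullback_exists hlim q e) as (F & i & k & hF).
assert (hi : E F P i) by exact (hE _ _ _ _ _ _ _ _ hF hq he).
assert (hk : M F one k).
{ apply hN; exact (hpb _ _ _ _ _ _ _ _ (pullback_sym hF) hq). }
destruct (@hone P) as (tP & _ & _).
(* As [i] is in [E] and [F] in [M/1], the identity of [F] extends along [i] to a retraction [r]. *)
destruct (fs_orth hEM hi hk (u := id F) (v := tP)) as (r & [hri _] & _).
{ apply (terminal_hom_eq hone). }
exists (i ∘ (r ∘ u)); split; [split |].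
- rewrite comp_assoc, (proj1 hF), <- comp_assoc.
  rewrite (terminal_hom_eq hone (k ∘ (r ∘ u)) (id one)); apply comp_id_r.
- intros S t ht s.
  (* Both maps agree after [i] and land in an object of [M/1], so orthogonality identifies them. *)
  assert (hs : s = s ∘ i ∘ r).
  { destruct (fs_orth hEM hi ht (u := s ∘ i) (v := tP)) as (d & _ & ud).
    { apply (terminal_hom_eq hone). }
    rewrite <- (ud (s ∘ i ∘ r)), <- (ud s); [reflexivity | |];
      split; try apply (terminal_hom_eq hone); [reflexivity |].
    now rewrite <- comp_assoc, hri, comp_id_r. }
  rewrite hs at 1; now rewrite !comp_assoc.
- intros v [hv huv].
  destruct (proj2 hF one v (id one)) as (w & [hw _] & _).
  { now rewrite hv, comp_id_r. }
  (* The retraction [r] itself serves as the test map for [SameComponent]. *)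
  rewrite (huv F k hk r), <- hw.
  now rewrite (comp_assoc r), hri, comp_id_l.
Qed.

Lemma connected_refl (M : MorphismClass C) (X : C) (A B : SliceOb X)
  (a : hom one (slice_dom A)) (b : hom one (slice_dom B)) :
  Connected M a b a b.
Proof.
intros P p q hP u v <- <- hv1 hv2; now rewrite (pullback_ext hP hv1 hv2).
Qed.

(** The middle pair has to agree over [X] to give a point [v] of the pullback; otherwise both
    connectedness assumptions would be vacuous. *)
Lemma connected_trans (M : MorphismClass C) (X : C) (A B : SliceOb X)
  (a0 a1 a2 : hom one (slice_dom A)) (b0 b1 b2 : hom one (slice_dom B)) :
  slice_arr A ∘ a1 = slice_arr B ∘ b1 ->
  Connected M a0 b0 a1 b1 -> Connected M a1 b1 a2 b2 ->
  Connected M a0 b0 a2 b2.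
Proof.
intros h1 h01 h12 P p q hP u w hu1 hu2 hw1 hw2 S t ht s.
destruct (proj2 hP one a1 b1 h1) as (v & [hv1 hv2] & _).
transitivity (s ∘ v).
- exact (h01 P p q hP u v hu1 hu2 hv1 hv2 S t ht s).
- exact (h12 P p q hP v w hv1 hv2 hw1 hw2 S t ht s).
Qed.

Lemma connected_sym_swap (M M' : MorphismClass C)
  (hM : forall (S : C) (t : hom S one), M' S one t -> M S one t)
  (X : C) (A B : SliceOb X)
  (a a' : hom one (slice_dom A)) (b b' : hom one (slice_dom B)) :
  Connected M a b a' b' -> Connected M' b' a' b a.
Proof.
intros h Q q p hQ u v hu1 hu2 hv1 hv2 S t ht s; symmetry.
exact (h Q p q (pullback_sym hQ) v u hv2 hv1 hu2 hu1 S t (hM S t ht) s).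
Qed.

(** The maps [h] and [k] induce [l] between the pullbacks, and a test map [s] on the target
    restricts to the test map [s ∘ l]. *)
Lemma connected_map (M : MorphismClass C) (X : C) (A B A' B' : SliceOb X)
  (h : SliceHom A A') (k : SliceHom B B')
  (a0 a1 : hom one (slice_dom A)) (b0 b1 : hom one (slice_dom B)) :
  Connected M a0 b0 a1 b1 ->
  Connected M (proj1_sig h ∘ a0) (proj1_sig k ∘ b0)
              (proj1_sig h ∘ a1) (proj1_sig k ∘ b1).
Proof.
intros h01 P' p' q' hP' u' v' hu1 hu2 hv1 hv2 S t ht s.
destruct (pullback_exists hlim (slice_arr A) (slice_arr B))
  as (P & p & q & hP).
assert (lift : forall (w : hom one P') a b,
  p' ∘ w = proj1_sig h ∘ a -> q' ∘ w = proj1_sig k ∘ b ->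
  exists w0 : hom one P, p ∘ w0 = a /\ q ∘ w0 = b).
{ intros w a b hwa hwb; destruct (proj2 hP one a b) as (w0 & hw0 & _).
  - rewrite <- (proj2_sig h), <- (proj2_sig k), <- !comp_assoc, <- hwa, <- hwb.
    now rewrite !comp_assoc, (proj1 hP').
  - now exists w0. }
destruct (lift u' a0 b0 hu1 hu2) as (u & ua & ub).
destruct (lift v' a1 b1 hv1 hv2) as (v & va & vb).
destruct (proj2 hP' P (proj1_sig h ∘ p) (proj1_sig k ∘ q))
  as (l & [l1 l2] & _).
{ rewrite !comp_assoc, (proj2_sig h), (proj2_sig k); exact (proj1 hP). }
assert (hu' : u' = l ∘ u).
{ apply (pullback_ext hP'); rewrite comp_assoc.
  - now rewrite l1, <- comp_assoc, ua.
  - now rewrite l2, <- comp_assoc, ub. }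
assert (hv' : v' = l ∘ v).
{ apply (pullback_ext hP'); rewrite comp_assoc.
  - now rewrite l1, <- comp_assoc, va.
  - now rewrite l2, <- comp_assoc, vb. }
rewrite hu', hv', !comp_assoc.
exact (h01 P p q hP u v ua ub va vb S t ht (s ∘ l)).
Qed.

End Components.

(** * Transposition between slice and coslice arrows *)

(* A and B are the slice and the coslice projection of one and the same
   point. *)
Record DualPair (C : Category) (E M E' M' : MorphismClass C) (one X : C)
  (A B : SliceOb X) : Type := {
  dp_e : hom one (slice_dom A);
  dp_e' : hom one (slice_dom B);
  dp_E : E _ _ dp_e;
  dp_E' : E' _ _ dp_e';
  dp_M : M _ _ (slice_arr A);
  dp_M' : M' _ _ (slice_arr B);
  dp_point : slice_arr A ∘ dp_e = slice_arr B ∘ dp_e'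
}.

Definition dual_pair_sym (C : Category) (E M E' M' : MorphismClass C)
  (one X : C) (A B : SliceOb X) (d : DualPair E M E' M' one A B) :
  DualPair E' M' E M one B A :=
  {| dp_e := dp_e' d; dp_e' := dp_e d; dp_E := dp_E' d; dp_E' := dp_E d;
     dp_M := dp_M' d; dp_M' := dp_M d; dp_point := eq_sym (dp_point d) |}.

(** Let x and y be the points of [d1] and [d2]. In the product of ↑x and ↓y, [g] names a point over
    y and [f] a point over x, each paired with a universal point; the two must share a component. *)
Definition Transposes (C : Category) (E M E' M' : MorphismClass C) (one X : C)
  (A1 B1 A2 B2 : SliceOb X)
  (d1 : DualPair E M E' M' one A1 B1) (d2 : DualPair E M E' M' one A2 B2)
  (f : SliceHom A1 A2) (g : SliceHom B2 B1) : Prop :=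
  Connected M (proj1_sig g ∘ dp_e' d2) (dp_e d2)
              (dp_e' d1) (proj1_sig f ∘ dp_e d1).

Section Transposition.

Context (C : Category) (one : C) (hone : IsTerminal one) (X : C).

(** The point [v] given by [f] has a unique representative [u] in the fibre of [q] over the
    universal point of [A2]; its coordinate in [B1] extends uniquely to [g]. *)
Lemma transpose_unique_exists (E M E' M' : MorphismClass C)
  (hC : BalancedFactorizationCategory E M E' M') (hstrong : Strong M M' one)
  (A1 B1 A2 B2 : SliceOb X)
  (d1 : DualPair E M E' M' one A1 B1) (d2 : DualPair E M E' M' one A2 B2)
  (f : SliceHom A1 A2) :
  exists! g : SliceHom B2 B1, Transposes d1 d2 f g.
Proof.
destruct (pullback_exists (bfc_finitely_complete hC)
  (slice_arr B1) (slice_arr A2)) as (P & p & q & hP).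
assert (hq : M' _ _ q).
{ exact (right_class_pullback (bfc_fs' hC) (pullback_sym hP) (dp_M' d1)). }
destruct (proj2 hP one (dp_e' d1) (proj1_sig f ∘ dp_e d1))
  as (v & [hv1 hv2] & _).
{ now rewrite comp_assoc, (proj2_sig f), <- (dp_point d1). }
destruct (unique_fiber_representative (bfc_finitely_complete hC) hone
  (bfc_fs hC) (bfc_stable hC) (right_class_pullback (bfc_fs' hC))
  (fun S t => proj2 (hstrong (MkSliceOb t))) hq (dp_E d2) v)
  as (u & [hu hvu] & uu).
destruct (slice_hom_extension (A := B2) (B := B1) (bfc_fs' hC) (u := p ∘ u)
  (dp_E' d2) (dp_M' d1)) as (g & hg & ug).
{ now rewrite comp_assoc, (proj1 hP), <- comp_assoc, hu, (dp_point d2). }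
exists g; split.
(* [Connected] ranges over all pullbacks; the comparison [l] carries the result from [P] to [P0]. *)
- intros P0 p0 q0 hP0 u0 v0 hu1 hu2 hv01 hv02 S t ht s.
  destruct (proj2 hP0 P p q (proj1 hP)) as (l & [l1 l2] & _).
  assert (e1 : u0 = l ∘ u).
  { apply (pullback_ext hP0); rewrite comp_assoc.
    - now rewrite l1, hu1.
    - now rewrite l2, hu2. }
  assert (e2 : v0 = l ∘ v).
  { apply (pullback_ext hP0); rewrite comp_assoc.
    - now rewrite l1, hv1.
    - now rewrite l2, hv2. }
  rewrite e1, e2, !comp_assoc; symmetry; exact (hvu S t ht (s ∘ l)).
- intros g' hg'; apply ug.
  destruct (proj2 hP one (proj1_sig g' ∘ dp_e' d2) (dp_e d2))
    as (u' & [hu1 hu2] & _).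
  { now rewrite comp_assoc, (proj2_sig g'), (dp_point d2). }
  rewrite <- hu1, (uu u'); [reflexivity |]; split; [exact hu2 |].
  intros S t ht s; symmetry.
  exact (hg' P p q hP u' v hu1 hu2 hv1 hv2 S t ht s).
Qed.

Context (E M E' M' : MorphismClass C).
Context (hC : BalancedFactorizationCategory E M E' M').
Context (hstrong : Strong M M' one).

Lemma bfc_swap : BalancedFactorizationCategory E' M' E M.
Proof. destruct hC; now split. Qed.

(** Swapping the two systems, and [d1] with [d2], exchanges the roles of [f] and [g]; strength
    matches the two notions of component. *)
Lemma transpose_unique_exists' (A1 B1 A2 B2 : SliceOb X)
  (d1 : DualPair E M E' M' one A1 B1) (d2 : DualPair E M E' M' one A2 B2)
  (g : SliceHom B2 B1) :
  exists! f : SliceHom A1 A2, Transposes d1 d2 f g.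
Proof.
assert (hstrong' : Strong M' M one) by (intros A; symmetry; apply hstrong).
destruct (transpose_unique_exists bfc_swap hstrong'
  (dual_pair_sym d2) (dual_pair_sym d1) g) as (f & hf & uf).
exists f; split.
- refine (connected_sym_swap _ hf).
  intros S t; exact (proj1 (hstrong (MkSliceOb t))).
- intros f' hf'; apply uf; refine (connected_sym_swap _ hf').
  intros S t; exact (proj2 (hstrong (MkSliceOb t))).
Qed.

Lemma transposes_id (A B : SliceOb X) (d : DualPair E M E' M' one A B) :
  Transposes d d (slice_id A) (slice_id B).
Proof. unfold Transposes; simpl; rewrite !comp_id_l; apply connected_refl. Qed.

(** The two pairs are joined through [g1 ∘ dp_e' d2] and [f2 ∘ dp_e d2]: apply [g1] to the second
    relation and [f2] to the first. *)
Lemma transposes_comp (A1 B1 A2 B2 A3 B3 : SliceOb X)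
  (d1 : DualPair E M E' M' one A1 B1) (d2 : DualPair E M E' M' one A2 B2)
  (d3 : DualPair E M E' M' one A3 B3)
  (f1 : SliceHom A1 A2) (g1 : SliceHom B2 B1)
  (f2 : SliceHom A2 A3) (g2 : SliceHom B3 B2) :
  Transposes d1 d2 f1 g1 -> Transposes d2 d3 f2 g2 ->
  Transposes d1 d3 (slice_comp f2 f1) (slice_comp g1 g2).
Proof.
intros h1 h2; unfold Transposes; simpl; rewrite <- !comp_assoc.
apply connected_trans
  with (a1 := proj1_sig g1 ∘ dp_e' d2) (b1 := proj1_sig f2 ∘ dp_e d2).
- rewrite !comp_assoc, (proj2_sig g1), (proj2_sig f2).
  symmetry; apply dp_point.
- pose proof (connected_map (bfc_finitely_complete hC)
    (h := g1) (k := slice_id A3) h2) as h; simpl in h.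
  now rewrite !comp_id_l in h.
- pose proof (connected_map (bfc_finitely_complete hC)
    (h := slice_id B1) (k := f2) h1) as h; simpl in h.
  now rewrite !comp_id_l in h.
Qed.

End Transposition.

(** * Equivalences from correspondences of arrows *)

(* A functional correspondence between arrows, over a correspondence between
   objects which is total on both sides but need not be functional. *)
Section Correspondence.

Context (C D : Category) (R : C -> D -> Type).
Context (T : forall (A1 A2 : C) (B1 B2 : D), R A1 B1 -> R A2 B2 ->
  hom A1 A2 -> hom B1 B2 -> Prop).
Context (T_right : forall (A1 A2 : C) (B1 B2 : D)
  (r1 : R A1 B1) (r2 : R A2 B2) f, exists! g, T r1 r2 f g).
Context (T_left : forall (A1 A2 : C) (B1 B2 : D)
  (r1 : R A1 B1) (r2 : R A2 B2) g, exists! f, T r1 r2 f g).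
Context (T_id : forall (A : C) (B : D) (r : R A B), T r r (id A) (id B)).
Context (T_comp : forall (A1 A2 A3 : C) (B1 B2 B3 : D)
  (r1 : R A1 B1) (r2 : R A2 B2) (r3 : R A3 B3) f1 g1 f2 g2,
  T r1 r2 f1 g1 -> T r2 r3 f2 g2 -> T r1 r3 (f2 ∘ f1) (g2 ∘ g1)).

Lemma correspondence_inj_right (A1 A2 : C) (B1 B2 : D)
  (r1 : R A1 B1) (r2 : R A2 B2) f g g' :
  T r1 r2 f g -> T r1 r2 f g' -> g = g'.
Proof.
intros h h'; destruct (T_right r1 r2 f) as (k & _ & uk).
now rewrite <- (uk g h), <- (uk g' h').
Qed.

Lemma correspondence_inj_left (A1 A2 : C) (B1 B2 : D)
  (r1 : R A1 B1) (r2 : R A2 B2) f f' g :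
  T r1 r2 f g -> T r1 r2 f' g -> f = f'.
Proof.
intros h h'; destruct (T_left r1 r2 g) as (k & _ & uk).
now rewrite <- (uk f h), <- (uk f' h').
Qed.

Definition push (A1 A2 : C) (B1 B2 : D) (r1 : R A1 B1) (r2 : R A2 B2)
  (f : hom A1 A2) : {g : hom B1 B2 | T r1 r2 f g}.
Proof.
apply constructive_indefinite_description.
destruct (T_right r1 r2 f) as (g & hg & _); now exists g.
Defined.

Definition pull (A1 A2 : C) (B1 B2 : D) (r1 : R A1 B1) (r2 : R A2 B2)
  (g : hom B1 B2) : {f : hom A1 A2 | T r1 r2 f g}.
Proof.
apply constructive_indefinite_description.
destruct (T_left r1 r2 g) as (f & hf & _); now exists f.
Defined.

Context (total_right : forall A : C, {B : D & R A B}).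
Context (total_left : forall B : D, {A : C & R A B}).

Definition push_functor : Functor C D.
Proof.
refine {| fob := fun A => projT1 (total_right A);
  fmap := fun A1 A2 f => proj1_sig
    (push (projT2 (total_right A1)) (projT2 (total_right A2)) f) |}.
- intros A; eapply correspondence_inj_right; [apply proj2_sig | apply T_id].
- intros A1 A2 A3 f2 f1; eapply correspondence_inj_right;
    [apply proj2_sig | eapply T_comp; apply proj2_sig].
Defined.

Definition pull_functor : Functor D C.
Proof.
refine {| fob := fun B => projT1 (total_left B);
  fmap := fun B1 B2 g => proj1_sig
    (pull (projT2 (total_left B1)) (projT2 (total_left B2)) g) |}.
- intros B; eapply correspondence_inj_left; [apply proj2_sig | apply T_id].
- intros B1 B2 B3 g2 g1; eapply correspondence_inj_left;
    [apply proj2_sig | eapply T_comp; apply proj2_sig].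
Defined.

(** The inverse corresponds to the identity with [r1] and [r2] exchanged; both composites then
    correspond to an identity. *)
Lemma correspondence_iso_left (A1 A2 : C) (B : D)
  (r1 : R A1 B) (r2 : R A2 B) (f : hom A1 A2) :
  T r1 r2 f (id B) -> IsIso f.
Proof.
intros hf; destruct (pull r2 r1 (id B)) as [f' hf']; exists f'; split;
  eapply correspondence_inj_left;
  try (eapply T_comp; eassumption); rewrite comp_id_l; apply T_id.
Qed.

Lemma correspondence_iso_right (A : C) (B1 B2 : D)
  (r1 : R A B1) (r2 : R A B2) (g : hom B1 B2) :
  T r1 r2 (id A) g -> IsIso g.
Proof.
intros hg; destruct (push r2 r1 (id A)) as [g' hg']; exists g'; split;
  eapply correspondence_inj_right;
  try (eapply T_comp; eassumption); rewrite comp_id_l; apply T_id.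
Qed.

Lemma correspondence_equivalent : Equivalent C D.
Proof.
exists push_functor, pull_functor; split.
- exists (fun A => proj1_sig (pull
    (projT2 (total_left (projT1 (total_right A))))
    (projT2 (total_right A)) (id _))); split.
  + intros A; eapply correspondence_iso_left; apply proj2_sig.
  (* Both sides of the naturality square correspond to the image of [f]. *)
  + intros A1 A2 f; simpl; eapply correspondence_inj_left;
      [eapply T_comp; apply proj2_sig |].
    rewrite comp_id_l, <- comp_id_r; eapply T_comp; apply proj2_sig.
- exists (fun B => proj1_sig (push
    (projT2 (total_right (projT1 (total_left B))))
    (projT2 (total_left B)) (id _))); split.
  + intros B; eapply correspondence_iso_right; apply proj2_sig.
  + intros B1 B2 g; simpl; eapply correspondence_inj_right;
      [eapply T_comp; apply proj2_sig |].
    rewrite comp_id_l, <- (comp_id_r (proj1_sig (pull _ _ g)));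
      eapply T_comp; apply proj2_sig.
Qed.

End Correspondence.

(** * Duality of slice and coslice projections *)

(** An object only asserts that its point exists, so choice selects one as data; factoring it in the
    other system gives the partner. *)
Lemma dual_pair_exists (C : Category) (E M E' M' : MorphismClass C)
  (hEM' : FactorizationSystem E' M') (one X : C)
  (A : ProjectionCategory E M one X) :
  {B : ProjectionCategory E' M' one X &
    DualPair E M E' M' one (proj1_sig (proj1_sig A)) (proj1_sig (proj1_sig B))}.
Proof.
destruct A as [[A hA] hx].
destruct (constructive_indefinite_description _ hx) as [x hx'].
destruct (constructive_indefinite_description _ hx') as [e [he hex]].
destruct (constructive_indefinite_description _ (fs_factor hEM' x)) as [I hI].
destruct (constructive_indefinite_description _ hI) as [e' he'].
destruct (constructive_indefinite_description _ he') as (m' & hE' & hM' & hme).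
unshelve eexists.
- exists (exist _ (MkSliceOb m') hM'); now exists x, e'.
- exists e e'; auto; simpl in *; congruence.
Qed.

Theorem corollary9p4 (C : Category) (E M E' M' : MorphismClass C)
  (hC : BalancedFactorizationCategory E M E' M')
  (one : C) (hone : IsTerminal one) (hstrong : Strong M M' one) (X : C) :
  Dual (ProjectionCategory E M one X) (ProjectionCategory E' M' one X).
Proof.
apply (@correspondence_equivalent (ProjectionCategory E M one X)
  (Op (ProjectionCategory E' M' one X))
  (fun A B => DualPair E M E' M' one
     (proj1_sig (proj1_sig A)) (proj1_sig (proj1_sig B)))
  (fun A1 A2 B1 B2 d1 d2 f g => Transposes d1 d2 f g)).
- intros; now apply transpose_unique_exists.
- intros; now apply transpose_unique_exists'.
- intros; apply transposes_id.
- intros A1 A2 A3 B1 B2 B3 d1 d2 d3 f1 g1 f2 g2.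
  now apply transposes_comp.
- apply dual_pair_exists; exact (bfc_fs' hC).
(* The same construction with the two systems exchanged. *)
- intros B; destruct (dual_pair_exists (bfc_fs hC) B) as [A d].
  exists A; exact (dual_pair_sym d).
Qed.
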